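(* Let $\mathfrak C$ be a left cancellative small category. Then $I_l\,\bar\ltimes\,\partial\Omega$ is Hausdorff if and only if for all $s\in I_l$ there exist $\varepsilon_1,\dots,\varepsilon_n\in\bar{\mathcal J}$ with $s\varepsilon_i=\varepsilon_i$ such that for all $\emptyset\ne e\in\mathcal J$ with $se=e$ there exists $1\le i\le n$ such that $e\varepsilon_i\ne\emptyset$.
   Context: $\mathfrak C$ denotes the set of morphisms, $\mathfrak C^0\subseteq\mathfrak C$ the identity morphisms, $\mathfrak d,\mathfrak t$ domain and target; $cd$ is defined iff $\mathfrak d(c)=\mathfrak t(d)$; left cancellative means $cx=cy\Rightarrow x=y$. Each $c\in\mathfrak C$ gives the partial bijection $\mathfrak d(c)\mathfrak C\to c\mathfrak C$, $x\mapsto cx$; $I_l$ is the smallest semigroup of partial bijections of $\mathfrak C$ containing these and closed under inverses; $\mathcal J=\{\mathrm{dom}(s):s\in I_l\}$ is its semilattice of idempotents (product = intersection). $\bar{\mathcal J}$ is the set of subsets $\varepsilon=e\setminus\bigcup_{i=1}^nf_i$ of $\mathfrak C$ with $e,f_1,\dots,f_n\in\mathcal J$, $f_i\subseteq e$. For $s\in I_l$ and a set $\varepsilon\in\bar{\mathcal J}$, $s\varepsilon$ is the restriction of $s$ to $\varepsilon\cap\mathrm{dom}(s)$; $s\varepsilon=\varepsilon$ means $\varepsilon\subseteq\mathrm{dom}(s)$ and $s(x)=x$ for all $x\in\varepsilon$; $e\varepsilon=e\cap\varepsilon$. The list $\varepsilon_1,\dots,\varepsilon_n$ may be empty. $\widehat{\mathcal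 J}$ is the space of non-zero multiplicative maps $\chi:\mathcal J\to\{0,1\}$ with $\chi(\emptyset)=0$ if $\emptyset\in\mathcal J$ (pointwise convergence). $\Omega\subseteq\widehat{\mathcal J}$ consists of those $\chi$ such that whenever $e=\bigcup_{i=1}^nf_i$ ($e,f_i\in\mathcal J$) and $\chi(e)=1$, then $\chi(f_i)=1$ for some $i$. For $\chi\in\Omega$, $\varepsilon=e\setminus\bigcup f_i\in\bar{\mathcal J}$, put $\chi(\varepsilon)=1$ iff $\chi(e)=1$ and all $\chi(f_i)=0$, and $\chi(\varepsilon)=0$ otherwise. $\partial\Omega\subseteq\Omega$ is the closure of the set of $\chi\in\widehat{\mathcal J}$ with $\chi^{-1}(1)$ maximal. $s\in I_l$ acts by $\chi\mapsto s.\chi=\chi(s^{-1}\cdot s)$ from $\{\chi\in\partial\Omega:\chi(s^{-1}s)=1\}$ onto $\{\chi\in\partial\Omega:\chi(ss^{-1})=1\}$. $I_l\,\bar\ltimes\,\partial\Omega$ is the groupoid of classes $[s,\chi]^{\bar\sim}$, $s\in I_l$, $\chi\in\partial\Omega$, $\chi(s^{-1}s)=1$, where $(s,\chi)\bar\sim(t,\psi)$ iff $\chi=\psi$ and $s\varepsilon=t\varepsilon$ for some $\varepsilon\in\bar{\mathcal J}$ with $\chi(\varepsilon)=1$; source $\chi$, range $s.\chi$; topology such that the sets $\{[s,\chi]^{\bar\sim}:\chi(s^{-1}s)=1\}$ are open and mapped homeomorphically by the source map onto $\{\chi\in\partial\Omega:\chi(s^{-1}s)=1\}$. *)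

(* Defs.v *)
From HB Require Import structures.
From mathcomp Require Import all_boot generic_quotient.
From mathcomp Require Import all_classical topology.

Set Implicit Arguments.
Unset Strict Implicit.
Unset Printing Implicit Defensive.

Local Open Scope classical_set_scope.
Local Open Scope quotient_scope.

(* A small category is given by its set of morphisms; objects are identified
   with their identity morphisms, so that [dom] and [tgt] take values in the
   identities.  The product [comp c d] (also written [c d], first d then c) is
   meaningful only when [dom c = tgt d]; its other values are junk, and are
   never referred to below. *)
Record smallCategory := SmallCategory {
  mor :> Type;
  dom : mor -> mor;
  tgt : mor -> mor;
  comp : mor -> mor -> mor;
  dom_dom : forall c, dom (dom c) = dom c;
  tgt_dom : forall c, tgt (dom c) = dom c;
  dom_tgt : forall c, dom (tgt c) = tgt c;
  tgt_tgt : forall c, tgt (tgt c) = tgt c;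
  dom_comp : forall c d, dom c = tgt d -> dom (comp c d) = dom d;
  tgt_comp : forall c d, dom c = tgt d -> tgt (comp c d) = tgt c;
  comp_dom : forall c, comp c (dom c) = c;
  tgt_compl : forall c, comp (tgt c) c = c;
  compA : forall b c d, dom b = tgt c -> dom c = tgt d ->
    comp b (comp c d) = comp (comp b c) d
}.

Definition left_cancellative (C : smallCategory) : Prop :=
  forall c x y : C, dom c = tgt x -> dom c = tgt y ->
    comp c x = comp c y -> x = y.

Record lcCategory := LcCategory {
  lc_cat :> smallCategory;
  lc_cancel : left_cancellative lc_cat
}.

Section InverseSemigroup.
Variable C : lcCategory.

(* Partial bijections of C are represented by their graphs, with the product
   and inverse of relations; [s \; t] is "first t, then s". *)

(* x |-> c x, from (dom c) C = {x | tgt x = dom c} onto c C *)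
Definition lmul (c : C) : set (C * C) :=
  [set xy | dom c = tgt xy.1 /\ xy.2 = comp c xy.1].

Inductive Il : set (set (C * C)) :=
| Il_lmul c : Il (lmul c)
| Il_comp s t : Il s -> Il t -> Il (s \; t)%relation
| Il_inv s : Il s -> Il (s^-1)%relation.

Lemma Il_bij s : Il s ->
  (forall x y z, s (x, y) -> s (x, z) -> y = z) /\
  (forall x y z, s (x, z) -> s (y, z) -> x = y).
Proof.
elim=> [c|{}s t _ [sf si] _ [tf ti]|{}s _ [sf si]]; split=> x y z //=.
- by rewrite /lmul /= => -[_ ->] [_ ->].
- by rewrite /lmul /= => -[cx ->] [cy]; exact: lc_cancel.
- case=> u /= txu suy [v /= txv svz]; apply: (sf u) => //.
  by rewrite (tf _ _ _ txu txv).
- case=> u /= txu suz [v /= tyv svz]; apply: (ti _ _ u) => //.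
  by rewrite (si _ _ _ suz svz).
- exact: si.
- exact: sf.
Qed.

(* The semilattice of domains; idempotents of Il correspond to their domains,
   and s^-1 s to the domain of s. *)
Definition J : set (set C) := [set s.`1 | s in Il].

Lemma J_setI : setI_closed J.
Proof.
move=> _ _ [s Is <-] [t It <-].
exists (s \; (t^-1 \; t))%relation; first by do ![constructor].
have [_ ti] := Il_bij It.
apply/seteqP; split=> x /=.
  case=> y [z [u txu tzu] szy]; have xz := ti _ _ _ txu tzu.
  by rewrite -xz in szy; split; [exists y|exists u].
by case=> -[y sxy] [u txu]; exists y, x => //; exists u.
Qed.

Definition capJ (e f : J) : J :=
  SigSub (mem_set (J_setI (set_valP e) (set_valP f))).

Definition domJ (s : Il) : J :=
  SigSub (mem_set (imageP (fun s => s.`1) (set_valP s))).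

Definition is_diff (e : J) n (f : 'I_n -> J) (eps : set C) : Prop :=
  (forall i, val (f i) `<=` val e) /\
  eps = val e `\` \bigcup_i val (f i).

Definition Jbar : set (set C) :=
  [set eps | exists e n (f : 'I_n -> J), is_diff e f eps].

Definition restr (s : set (C * C)) (A : set C) : set (C * C) :=
  [set xy | A xy.1 /\ s xy].

(* s A = A: every x in A lies in the domain of s and s(x) = x *)
Definition fixes (s : set (C * C)) (A : set C) : Prop :=
  forall x, A x -> s (x, x).

Definition Jhat : set {ptws J -> bool} :=
  [set chi : {ptws J -> bool} | [/\ exists e, chi e,
    forall e f : J, chi (capJ e f) = chi e && chi f &
    forall e : J, val e = set0 -> chi e = false]].

Definition Omega : set Jhat :=
  [set chi : Jhat | forall (e : J) n (f : 'I_n -> J),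
    val e = \bigcup_i val (f i) -> val chi e ->
    exists i, val chi (f i)].

Definition maxchar : set Jhat :=
  [set chi : Jhat | forall psi : Jhat,
    (forall e, val chi e -> val psi e) ->
    forall e, val psi e -> val chi e].

Definition bdOmega : set Jhat := closure maxchar.

(* [chibar chi eps] is chi(eps) = 1; on Omega this does not depend on the way
   eps is written as a difference (see [chibarE]). *)
Definition chibar (chi : J -> bool) (eps : set C) : Prop :=
  exists e n (f : 'I_n -> J),
    [/\ is_diff e f eps, chi e & forall i, ~~ chi (f i)].

Definition bdval (chi : bdOmega) : J -> bool := val (val chi).

Lemma chi_sub (chi : Jhat) (e f : J) :
  val e `<=` val f -> val chi e -> val chi f.
Proof.
have [_ chiM _] := set_valP chi => ef chie.
have : val chi (capJ e f) = val chi e.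
  by congr (val chi _); apply: val_inj => /=; exact/setIidPl.
by rewrite chiM chie.
Qed.

Lemma chibarE (chi : Jhat) (e : J) n (f : 'I_n -> J) eps :
  Omega chi -> is_diff e f eps ->
  chibar (val chi) eps <->
  val chi e /\ forall i, ~~ val chi (f i).
Proof.
move=> Ochi ef; split=> [|[? ?]]; last by exists e, n, f.
have chiM (a b : J) : val chi (capJ a b) = val chi a && val chi b.
  by have [_ + _] := set_valP chi; exact.
case=> a [m [b [[ba ab] chia chib]]]; case: ef => fe ef.
have chie : val chi e.
  pose g (i : 'I_m.+1) := if unlift ord0 i is Some j then b j else capJ a e.
  case: (Ochi a m.+1 g) => //.
    apply/seteqP; split=> x.
      move=> ax; have [bx|nbx] := pselect ((\bigcup_i val (b i)) x).
        by case: bx => i _ bx; exists (lift ord0 i); rewrite // /g liftK.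
      have : eps x by rewrite ab.
      by rewrite ef => -[ex _]; exists ord0; rewrite // /g unlift_none.
    by case=> i _; rewrite /g; case: unliftP => [j _|_]; [exact: ba|case].
  move=> i; rewrite /g; case: unliftP => [j _|_]; last by rewrite chiM => /andP[].
  by rewrite (negbTE (chib j)).
split=> // i; apply/negP => chif.
have chiaf : val chi (capJ a (f i)) by rewrite chiM chia chif.
have [||j] := Ochi (capJ a (f i)) m (fun j => capJ (f i) (b j)); last 1 first.
- by rewrite chiM chif (negbTE (chib j)).
- apply/seteqP; split=> [x [/= ax fx]|x [j _ [/= fx bx]]]; last first.
    by split=> //; exact: ba bx.
  have [[j _ bx]|nbx] := pselect ((\bigcup_i val (b i)) x).
    by exists j.
  have : eps x by rewrite ab.
  by rewrite ef => -[_ []]; exists i.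
- exact: chiaf.
Qed.

Lemma eval_continuous (e : J) : continuous (fun chi : Jhat => val chi e : bool).
Proof.
move=> chi.
have c1 : {for chi, continuous (val : Jhat -> {ptws J -> bool})}.
  by rewrite -set_valE; exact: initial_continuous.
exact: (continuous_comp c1 (@proj_continuous J (fun=> bool) e (val chi))).
Qed.

Lemma near_eval (e : J) (chi : Jhat) :
  \forall psi \near chi, val psi e = val chi e.
Proof.
apply: (@eval_continuous e chi [set val chi e]).
by apply: open_nbhs_nbhs; split=> //; exact: discrete_open.
Qed.

Lemma near_chibar (chi : Jhat) eps : chibar (val chi) eps ->
  \forall psi \near chi, chibar (val psi) eps.
Proof.
move=> [e [n [f [ef chie chif]]]].
have fE : \forall psi \near chi, forall i, val psi (f i) = val chi (f i).
  apply: (@filter_forall _ _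
    (fun i (psi : Jhat) => val psi (f i) = val chi (f i)) (nbhs chi)).
  by move=> i; exact: near_eval.
near=> psi; exists e, n, f; split=> //; first by rewrite (near (near_eval e chi)).
by move=> i; rewrite (near fE).
Unshelve. all: by end_near. Qed.

Lemma maxchar_disjoint (chi : Jhat) (f : J) : maxchar chi -> ~~ val chi f ->
  exists2 g : J, val chi g & val g `&` val f = set0.
Proof.
move=> mchi chif; apply: contrapT => nog.
have [[g0 chig0] chiM chi0] := set_valP chi.
pose psi (h : J) := `[< exists2 g : J, val chi g & val g `&` val f `<=` val h >].
have psiP : Jhat psi.
  split.
  - by exists g0; apply/asboolP; exists g0 => // x [].
  - move=> a b; apply/asboolP/andP => [[g chig /= gab]|].
      by split; apply/asboolP; exists g => // x /gab[].
    case=> /asboolP[g chig ga] /asboolP[h chih hb]; exists (capJ g h).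
      by rewrite chiM chig.
    by move=> x [[gx hx] fx]; split; [exact: ga|exact: hb].
  - move=> e e0; apply/asboolP => -[g chig]; rewrite e0 subset0 => gf.
    by apply: nog; exists g.
move/negP: chif; apply; apply: (mchi (SigSub (mem_set psiP))) => /=.
  by move=> e chie; apply/asboolP; exists e => // x [].
by apply/asboolP; exists g0 => // x [].
Qed.

Lemma maxchar_Omega : maxchar `<=` Omega.
Proof.
move=> chi mchi e n f ef chie; apply: contrapT => nf.
have {nf}nf i : exists g : J, val chi g /\ val g `&` val (f i) = set0.
  have [|g gf g0] := @maxchar_disjoint chi (f i) mchi; last by exists g.
  by apply/negP => fi; apply: nf; exists i.
have [_ chiM chi0] := set_valP chi.
have [g gP] := choice nf.
pose h := foldr (fun i => capJ (g i)) e (enum 'I_n).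
have chih : val chi h.
  by rewrite /h; elim: (enum _) => //= i r; rewrite chiM (gP i).1.
have hg i x : val h x -> val (g i) x.
  have : i \in enum 'I_n by rewrite mem_enum.
  rewrite /h; elim: (enum _) => //= j r IH.
  by rewrite inE => /predU1P[->|/IH{}IH] [] // _ /IH.
have he x : val h x -> val e x.
  by rewrite /h; elim: (enum _) => //= j r IH [_ /IH].
have h0 : val h = set0.
  apply/seteqP; split=> // x hx; have := he _ hx.
  rewrite ef => -[i _ fx]; have := (gP i).2.
  by move=> <-; split=> //; exact: hg.
by move: chih; rewrite chi0.
Qed.

Lemma bdOmega_Omega : bdOmega `<=` Omega.
Proof.
move=> chi cchi e n f ef chie; apply: contrapT => nf.
have chif i : ~~ val chi (f i) by apply/negP => fi; apply: nf; exists i.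
have : nbhs chi [set psi : Jhat | chibar (val psi) set0].
  apply: near_chibar; exists e, n, f; split=> //; split=> [i x fx|].
    by rewrite ef; exists i.
  by rewrite ef setDv.
move=> /cchi[psi [/maxchar_Omega Opsi [e' [m [f' [[f'e e'f] psie psif]]]]]].
have [|i] := Opsi e' m f' _ psie; last by rewrite (negbTE (psif i)).
apply/seteqP; split=> [x e'x|x [i _ /f'e]//].
apply: contrapT => nx.
by have : set0 x by rewrite e'f.
Qed.

(* A pair (s, chi) with chi(s^-1 s) = 1. *)
Definition germ_pair : set (Il * bdOmega) :=
  [set p : Il * bdOmega | bdval p.2 (domJ p.1)].

Definition germ_sim (p q : germ_pair) : bool :=
  `[< (val p).2 = (val q).2 /\
      exists eps, [/\ Jbar eps, chibar (bdval (val p).2) eps &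
        restr (val (val p).1) eps = restr (val (val q).1) eps] >].

Lemma germ_sim_refl : reflexive germ_sim.
Proof.
move=> p; apply/asboolP; split=> //.
pose f (i : 'I_0) : J := domJ (val p).1.
have ef : is_diff (domJ (val p).1) f (val (domJ (val p).1)).
  split=> [[]//|]; apply/seteqP; split=> [x ?|x []//].
  by split=> // -[[]].
exists (val (domJ (val p).1)); split=> //.
- by exists (domJ (val p).1), 0, f.
- exists (domJ (val p).1), 0, f; split=> //; last by case.
  exact: (set_valP p).
Qed.

Lemma germ_sim_sym : symmetric germ_sim.
Proof.
move=> p q; apply/asboolP/asboolP => -[pq [eps [Jeps ceps seps]]];
  by split=> //; exists eps; split=> //; move: ceps; rewrite pq.
Qed.

Lemma chibarI (chi : Jhat) eps del :
  chibar (val chi) eps -> chibar (val chi) del -> chibar (val chi) (eps `&` del).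
Proof.
have [_ chiM _] := set_valP chi.
move=> [a [n [f [[fa ->] chia chif]]]] [b [m [g [[gb ->] chib chig]]]].
exists (capJ a b), (n + m), (fun i => match fintype.split i with
  inl j => capJ (f j) b | inr j => capJ a (g j) end); split.
- split=> [i|].
    by case: fintype.split => j x [/= fx gx]; split=> //; first [exact: fa fx|exact: gb gx].
  apply/seteqP; split=> x.
    move=> [[ax nf] [bx ng]]; split=> // -[i _].
    by case: fintype.split => j [/= ? ?]; [apply: nf; exists j|apply: ng; exists j].
  move=> [[/= ax bx] nfg]; split; split=> // -[j _ jx]; apply: nfg.
    by exists (unsplit (inl j)) => //; rewrite unsplitK.
  by exists (unsplit (inr j)) => //; rewrite unsplitK.
- by rewrite chiM chia.
- move=> i; case: fintype.split => j; rewrite chiM; first by rewrite (negbTE (chif j)).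
  by rewrite (negbTE (chig j)) andbF.
Qed.

Lemma chibar_Jbar (chi : J -> bool) eps : chibar chi eps -> Jbar eps.
Proof. by move=> [e [n [f [ef _ _]]]]; exists e, n, f. Qed.

Lemma restrI (s : set (C * C)) A B : restr s (A `&` B) = restr (restr s B) A.
Proof. by apply/seteqP; split=> -[x y] /=; rewrite /restr /=; tauto. Qed.

Lemma germ_sim_trans : transitive germ_sim.
Proof.
move=> q p r /asboolP[pq [eps [_ ceps seps]]] /asboolP[qr [del [_ cdel sdel]]].
apply/asboolP; split; first by rewrite pq.
have ced : chibar (bdval (val p).2) (eps `&` del).
  by apply: chibarI => //; rewrite pq.
exists (eps `&` del); split=> //; first exact: chibar_Jbar ced.
by rewrite setIC restrI seps -restrI setIC restrI sdel -restrI.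
Qed.

Canonical germ_equiv :=
  EquivRel germ_sim germ_sim_refl germ_sim_sym germ_sim_trans.

(* The space of germs [s, chi].  Range map and product of the groupoid are not
   introduced: being Hausdorff is a property of the topology alone. *)
Definition groupoid : Type := {eq_quot germ_equiv}.

HB.instance Definition _ := Choice.on groupoid.

Definition germ (p : germ_pair) : groupoid := \pi_({eq_quot germ_equiv}) p.

Definition bisection (s : Il) : set groupoid :=
  [set germ p | p in [set p : germ_pair | (val p).1 = s]].

Definition source (g : groupoid) : bdOmega :=
  (val (repr (g : {eq_quot germ_equiv}))).2.

(* W is open iff its trace on each bisection is open in bdOmega, when read
   through the source map. *)
Definition groupoid_open (W : set groupoid) : Prop :=
  forall s, open (source @` (bisection s `&` W)).

Lemma germP (p q : germ_pair) : germ p = germ q <-> germ_sim p q.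
Proof.
split; first by move/eqP; rewrite eqmodE.
by move=> pq; apply/eqP; rewrite eqmodE.
Qed.

Lemma germ_repr (g : groupoid) : germ (repr (g : {eq_quot germ_equiv})) = g.
Proof. exact: reprK. Qed.

Lemma source_germ (p : germ_pair) : source (germ p) = (val p).2.
Proof. by have /germP/asboolP[] := germ_repr (germ p). Qed.

Lemma source_bisection_inj s g h :
  bisection s g -> bisection s h -> source g = source h -> g = h.
Proof.
move=> [p ps <-] [q qs <-]; rewrite !source_germ => pq.
by congr germ; apply: val_inj; rewrite (surjective_pairing (val p)) ps pq -qs -surjective_pairing.
Qed.

Lemma source_bisection s :
  source @` bisection s = [set chi : bdOmega | bdval chi (domJ s)].
Proof.
apply/seteqP; split=> [_ [_ [p ps <-] <-]|chi chis] /=.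
  by rewrite source_germ -ps; exact: (set_valP p).
have sP : germ_pair (s, chi) by [].
exists (germ (SigSub (mem_set sP))); first by exists (SigSub (mem_set sP)).
by rewrite source_germ.
Qed.

Lemma near_bdval (e : J) (chi : bdOmega) :
  \forall psi \near chi, bdval psi e = bdval chi e.
Proof.
have c : {for chi, continuous (val : bdOmega -> Jhat)}.
  by rewrite -set_valE; exact: initial_continuous.
exact: (c _ (near_eval e (val chi))).
Qed.

Lemma open_domain (s : Il) : open [set chi : bdOmega | bdval chi (domJ s)].
Proof.
rewrite openE => chi /= chis; apply: filterS (near_bdval (domJ s) chi).
by move=> psi /= ->.
Qed.

Lemma groupoid_openT : groupoid_open setT.
Proof. by move=> s; rewrite setIT source_bisection; exact: open_domain. Qed.

Lemma groupoid_openI : setI_closed groupoid_open.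
Proof.
move=> V W oV oW s.
rewrite (_ : _ @` _ = source @` (bisection s `&` V) `&` source @` (bisection s `&` W)).
  exact: openI.
apply/seteqP; split=> [_ [g [sg [Vg Wg]] <-]|chi [[g [sg Vg] <-] [h [sh Wh] gh]]].
  by split; exists g.
by exists g => //; split=> //; split=> //; rewrite -(source_bisection_inj sh sg gh).
Qed.

Lemma groupoid_open_bigcup (I : Type) (V : I -> set groupoid) :
  (forall i, groupoid_open (V i)) -> groupoid_open (\bigcup_i V i).
Proof.
by move=> oV s; rewrite setI_bigcupr image_bigcup; apply: bigcup_open => i _; exact: oV.
Qed.

HB.instance Definition _ := isOpenTopological.Build groupoid
  groupoid_openT groupoid_openI groupoid_open_bigcup.

(* The topology just defined is the one for which the bisections are open and
   mapped homeomorphically to open sets by the source map. *)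
Lemma bisection_open s : open (bisection s).
Proof.
move=> t; rewrite openE => _ [_ [[p pt <-] [q qs pq]] <-].
rewrite source_germ; have /germP/asboolP[/= qp2 [eps [_ ceps seps]]] := pq.
have c : {for (val p).2, continuous (val : bdOmega -> Jhat)}.
  by rewrite -set_valE; exact: initial_continuous.
rewrite qp2 in ceps.
have n1 : \forall psi \near (val p).2, chibar (bdval psi) eps.
  exact: (c _ (near_chibar ceps)).
have n2 := near_bdval (domJ s) (val p).2.
have n3 := near_bdval (domJ t) (val p).2.
apply: (filterS _ (filterI n1 (filterI n2 n3))) => psi [/= ceps' [es et]].
have psit : bdval psi (domJ t) by rewrite et -pt; exact: (set_valP p).
have psis : bdval psi (domJ s) by rewrite es -qs -qp2; exact: (set_valP q).
have tP : germ_pair (t, psi) by [].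
have sP : germ_pair (s, psi) by [].
exists (germ (SigSub (mem_set tP))); last by rewrite source_germ.
split; first by exists (SigSub (mem_set tP)).
exists (SigSub (mem_set sP)) => //; apply/germP/asboolP; split=> //=.
exists eps; split=> //; first exact: chibar_Jbar ceps.
by rewrite -qs -pt.
Qed.

Lemma source_continuous : continuous source.
Proof.
apply/continuousP => U oU; change (groupoid_open (source @^-1` U)) => s.
rewrite (_ : _ @` _ = [set chi | bdval chi (domJ s)] `&` U).
  by apply: openI => //; exact: open_domain.
rewrite -source_bisection; apply/seteqP; split=> [_ [g [sg Ug] <-]|_ [[g sg <-] Ug]].
  by split=> //; exists g.
by exists g.
Qed.

Lemma source_open W : open W -> open (source @` W).
Proof.
move=> oW; have -> : W = \bigcup_s (bisection s `&` W).
  apply/seteqP; split=> [g Wg|g [s _ []//]].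
  exists (val (repr (g : {eq_quot germ_equiv}))).1 => //; split=> //.
  by exists (repr (g : {eq_quot germ_equiv})); last exact: germ_repr.
by rewrite image_bigcup; apply: bigcup_open => s _; exact: oW.
Qed.

End InverseSemigroup.

(* Main.v *)
Require Import Defs.
From mathcomp Require Import all_boot.
From mathcomp Require Import all_classical topology.

Set Implicit Arguments.
Unset Strict Implicit.
Unset Printing Implicit Defensive.

Local Open Scope classical_set_scope.

(**
The groupoid of germs fails to be Hausdorff only because of distinct germs
[s, chi] and [t, chi] with the same source, and these agree exactly when
s^-1 t is the identity on some eps in Jbar with chi(eps) = 1 ([germ_eqP]).
So, for u in Il, the set V(u) of those chi in the boundary at which u has the
germ of an identity ([unit_germ]) decides the matter.  It is the union of the
sets D(eps) = {chi | chi(eps) = 1}, over the eps in Jbar fixed by u, and every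
D(eps) is clopen.

If the groupoid is Hausdorff, then V(s) is closed: near a chi at which the
germs of s and s^-1 s differ, they still differ ([closed_unit_germ]).  As V(s)
lies in {chi | chi(dom s) = 1}, which is compact ([compact_bdval]), finitely
many D(eps_i) cover V(s).  A nonempty e in J fixed by s lies in some maximal
filter of J ([ex_maxchar]); the associated chi is in V(s), hence in some
D(eps_i), and then chi(e eps_i) = 1 forces e eps_i to be nonempty.

Conversely, let [s, chi] and [t, chi] be distinct, and let eps_1, ..., eps_n be
given for u = s^-1 t.  Then chi(eps_i) = 0 for all i, and this persists near
chi.  If the two bisections met over some psi near chi, u would fix some del
with psi(del) = 1; by density of the maximal characters, psi may be taken
maximal.  For such psi, a set of value 1 contains, and a set of value 0 is
disjoint from, a member of the filter of psi ([maxchar_chibar],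
[maxchar_nchibar]).  Intersecting these members yields a nonempty e in J, fixed
by u and disjoint from every eps_i, which is a contradiction.
*)

(** * Compact sets *)

(** Finite subcovers, in a space that is not required to have a base point. *)
Lemma compact_finite_subcover (T : topologicalType) (I : eqType) (K : set T)
    (D : set I) (U : I -> set T) :
  compact K -> (forall i, D i -> open (U i)) ->
  (forall x, K x -> exists2 i, D i & U i x) ->
  exists2 l : seq I, (forall i, i \in l -> D i) &
    forall x, K x -> exists2 i, i \in l & U i x.
Proof.
move=> cK oU KU.
(* Finite subfamilies, directed by inclusion. *)
pose F (A : set (seq I)) := exists l0 : seq I,
  forall l : seq I, {subset l0 <= l} -> A l.
have FF : Filter F.
  split.
  - by exists nil.
  - move=> A B [a aA] [b bB]; exists (a ++ b) => l abl; split.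
      by apply: aA => x xa; apply: abl; rewrite mem_cat xa.
    by apply: bB => x xb; apply: abl; rewrite mem_cat xb orbT.
  - by move=> A B AB [a aA]; exists a => l /aA /AB.
pose P (l : seq I) x := exists2 i, i \in l /\ D i & U i x.
have /compact_near_coveringP/(_ _ F P FF) := cK.
case.
  move=> x /KU[i Di Uix]; exists (U i, [set l | i \in l]) => /=.
    split; first by apply: open_nbhs_nbhs; split; first exact: oU.
    by exists [:: i] => l; apply; rewrite inE.
  by move=> [y l] [/= Uiy il]; exists i.
move=> l0 /(_ l0 (fun _ h => h)) l0P.
exists [seq i <- l0 | `[< D i >]].
  by move=> i; rewrite mem_filter => /andP[/asboolP].
move=> x /l0P[i [il0 Di] Uix]; exists i => //.
by rewrite mem_filter il0 andbT; apply/asboolP.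
Qed.

(** * Characters of the semilattice of domains *)

Section Characters.
Variable C : lcCategory.
Implicit Types (e f g : @J C) (chi psi : @Jhat C) (eps : set C).

Lemma char_capJ chi e f : val chi (capJ e f) = val chi e && val chi f.
Proof. by have [_ + _] := set_valP chi; exact. Qed.

Lemma char_empty chi e : val e = set0 -> ~~ val chi e.
Proof. by have [_ _ chi0] := set_valP chi; move=> /chi0 ->. Qed.

Lemma char_nonempty chi e : val chi e -> val e !=set0.
Proof.
by move=> chie; apply/set0P/eqP => e0; move: (char_empty chi e0); rewrite chie.
Qed.

(** The filter of a character is closed under finite intersections. *)
Lemma char_lower_bound chi e n (g : 'I_n -> @J C) :
  val chi e -> (forall i, val chi (g i)) ->
  exists2 h : @J C, val chi h &
    val h `<=` val e /\ forall i, val h `<=` val (g i).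
Proof.
move=> chie chig; exists (foldr (fun i => capJ (g i)) e (enum 'I_n)).
  by elim: (enum _) => //= i r IH; rewrite char_capJ chig.
split=> [|i]; first by elim: (enum _) => //= i r IH x [_ /IH].
have : i \in enum 'I_n by rewrite mem_enum.
by elim: (enum _) => //= j r IH; rewrite inE => /predU1P[->|/IH{}IH] x [] // _ /IH.
Qed.

(** Zorn's lemma: every filter of J lies in a maximal one. *)
Lemma Jhat_le_maxchar chi : exists2 psi, maxchar psi &
  forall e, val chi e -> val psi e.
Proof.
pose T := {psi : @Jhat C | `[< forall e, val chi e -> val psi e >]}.
pose R (u v : T) := `[< forall e, val (val u) e -> val (val v) e >].
have chiT : `[< forall e, val chi e -> val chi e >] by apply/asboolP.
have Tchi (u : T) e : val chi e -> val (val u) e.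
  by case: u => u /= /asboolP; exact.
pose t0 : T := exist _ chi chiT.
have [|||t tmax] := @ZL_preorder T t0 R.
- by move=> t; apply/asboolP.
- by move=> r s t /asboolP rs /asboolP st; apply/asboolP => e /rs /st.
- move=> A totA.
  (* The union of a nonempty chain of filters is a filter. *)
  have [[a0 Aa0]|A0] := pselect (A !=set0); last first.
    by exists t0 => s As; case: A0; exists s.
  pose u (e : @J C) : bool := `[< exists2 a, A a & val (val a) e >].
  have uP : Jhat u.
    split.
    - have [[e ea] _ _] := set_valP (val a0).
      by exists e; apply/asboolP; exists a0.
    - move=> e f; apply/asboolP/andP => [[a Aa]|].
        by rewrite char_capJ => /andP[ae af]; split; apply/asboolP; exists a.
      move=> [/asboolP[a Aa ae] /asboolP[b Ab bf]].
      have [/asboolP ab|/asboolP ba] := totA _ _ Aa Ab.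
        by exists b => //; rewrite char_capJ bf (ab _ ae).
      by exists a => //; rewrite char_capJ ae (ba _ bf).
    - by move=> e e0; apply/asboolP => -[a _]; apply/negP; exact: char_empty.
  have uT : `[< forall e, val chi e -> val (SigSub (mem_set uP) : @Jhat C) e >].
    by apply/asboolP => e chie; apply/asboolP; exists a0 => //; exact: Tchi.
  exists (exist _ (SigSub (mem_set uP)) uT : T) => s As; apply/asboolP => e se.
  by apply/asboolP; exists s.
exists (val t) => [psi tpsi e psie|]; last exact: Tchi.
have psiT : `[< forall e, val chi e -> val psi e >].
  by apply/asboolP => f chif; apply: tpsi; exact: Tchi.
have /tmax /asboolP : R t (exist _ psi psiT) by apply/asboolP.
exact.
Qed.

(** Extend the filter of all members of J containing a given point of [e]. *)
Lemma ex_maxchar e : val e !=set0 -> exists2 chi : @Jhat C, maxchar chi & val chi e.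
Proof.
move=> [x ex]; pose u (f : @J C) : bool := `[< val f x >].
have uP : Jhat u.
  split.
  - by exists e; apply/asboolP.
  - by move=> a b; apply/asboolP/andP => -[ax bx]; split; apply/asboolP.
  - by move=> f f0; apply/asboolP; rewrite f0.
have [psi mpsi upsi] := Jhat_le_maxchar (SigSub (mem_set uP)).
by exists psi => //; apply: upsi; apply/asboolP.
Qed.

Lemma chibar_J chi e : val chi e -> chibar (val chi) (val e).
Proof.
move=> chie; pose f (i : 'I_0) : @J C := e.
exists e, 0, f; split=> //; last by case.
split=> [[]//|]; apply/seteqP; split=> [x ?|x []//].
by split=> // -[[]].
Qed.

(** If e minus f_1, ..., f_n were empty, e would be the union of the f_i; then
    chi(e) = 1 and chi(f_i) = 0 for all i contradict membership in Omega. *)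
Lemma chibar_nonempty chi eps : Omega chi -> chibar (val chi) eps -> eps !=set0.
Proof.
move=> Ochi [e [n [f [[fe epsE] chie chif]]]].
apply/set0P/eqP => eps0; have [|i] := Ochi e n f _ chie; last exact/negP.
apply/seteqP; split=> [x ex|x [i _ /fe]//].
by apply: contrapT => nx; rewrite -[False]/(set0 x) -eps0 epsE; split.
Qed.

(** If [eps] is e minus f_1, ..., f_n, the f_i have value 0, so by maximality
    each of them is disjoint from some member of the filter of [chi]. *)
Lemma maxchar_chibar chi eps : maxchar chi -> chibar (val chi) eps ->
  exists2 g : @J C, val chi g & val g `<=` eps.
Proof.
move=> mchi [e [n [f [[fe ->] chie chif]]]].
have /choice[g gP] i : exists g : @J C, val chi g /\ val g `&` val (f i) = set0.
  by have [g] := maxchar_disjoint mchi (chif i); exists g.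
have [h chih [he hg]] := char_lower_bound chie (fun i => (gP i).1).
exists h => // x hx; split; first exact: he.
by move=> [i _ fx]; rewrite -[False]/(set0 x) -(gP i).2; split=> //; exact: hg.
Qed.

(** If [eps] is e minus f_1, ..., f_n, either e has value 0, and some member of
    the filter of [chi] is disjoint from it, or some f_i is in the filter. *)
Lemma maxchar_nchibar chi eps : maxchar chi -> Jbar eps ->
  ~ chibar (val chi) eps ->
  exists2 g : @J C, val chi g & val g `&` eps = set0.
Proof.
move=> mchi [e [n [f ef]]] nchi; have [fe epsE] := ef.
have [chie|chie] := boolP (val chi e); last first.
  have [g chig g0] := maxchar_disjoint mchi chie.
  exists g => //; apply/seteqP; split=> // x [gx].
  by rewrite epsE => -[ex _]; rewrite -g0.
have [i chif] : exists i, val chi (f i).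
  apply: contrapT => nf; apply: nchi; exists e, n, f; split=> // i.
  by apply/negP => chif; apply: nf; exists i.
exists (f i) => //; apply/seteqP; split=> // x [fx].
by rewrite epsE => -[_]; apply; exists i.
Qed.

End Characters.

(** * The boundary of the spectrum *)

Section BoundarySpectrum.
Variable C : lcCategory.
Implicit Types (e f g : @J C) (chi psi : @bdOmega C) (eps : set C).

Lemma val_bdOmega_continuous : continuous (val : @bdOmega C -> @Jhat C).
Proof. by rewrite -set_valE; exact: initial_continuous. Qed.

Lemma near_bdchibar chi eps : chibar (bdval chi) eps ->
  \forall psi \near chi, chibar (bdval psi) eps.
Proof. by move=> /near_chibar; exact: val_bdOmega_continuous. Qed.

Lemma open_chibar eps : open [set chi | chibar (bdval chi) eps].
Proof. by rewrite openE => chi; exact: near_bdchibar. Qed.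

(** The description of chi(eps) by a fixed way of writing eps as a difference,
    available on Omega only, shows that the condition chi(eps) = 0 is open. *)
Lemma near_bdnchibar chi eps : Jbar eps -> ~ chibar (bdval chi) eps ->
  \forall psi \near chi, ~ chibar (bdval psi) eps.
Proof.
move=> [e [n [f ef]]].
have E psi := chibarE (bdOmega_Omega (set_valP psi)) ef.
move=> nchi; have [chie|/negP chie] := boolP (bdval chi e); last first.
  apply: filterS (near_bdval e chi) => psi psie /E[].
  by rewrite -/(bdval psi e) psie.
have [i chif] : exists i, bdval chi (f i).
  apply: contrapT => nf; apply: nchi; apply/E; split=> // i.
  by apply/negP => chif; apply: nf; exists i.
apply: filterS (near_bdval (f i) chi) => psi psif /E[_ /(_ i)].
by rewrite -/(bdval psi (f i)) psif chif.
Qed.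

Lemma near_bdnchibar_all chi n (eps : 'I_n -> set C) :
  (forall i, Jbar (eps i)) -> (forall i, ~ chibar (bdval chi) (eps i)) ->
  \forall psi \near chi, forall i, ~ chibar (bdval psi) (eps i).
Proof.
move=> Jeps nchi.
apply: (@filter_forall _ _
  (fun i (psi : @bdOmega C) => ~ chibar (bdval psi) (eps i)) (nbhs chi)).
by move=> i; exact: near_bdnchibar.
Qed.

(** Maximal characters are dense in the boundary. *)
Lemma near_maxchar chi (U : set (@bdOmega C)) : nbhs chi U ->
  exists2 psi, U psi & maxchar (val psi).
Proof.
rewrite nbhsE => -[V [[W oW <-] chiW] VU].
have /(set_valP chi)[psi [mpsi Wpsi]] : nbhs (val chi) W.
  by apply: open_nbhs_nbhs; split=> //; move: chiW; rewrite set_valE.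
exists (SigSub (mem_set (subset_closure mpsi))) => //.
by apply: VU; rewrite /= set_valE.
Qed.

Lemma bdOmega_hausdorff : hausdorff_space (@bdOmega C).
Proof.
move=> chi psi cl; apply: val_inj; apply: val_inj; apply/funext => e.
have [xi [/= xe ye]] := cl _ _ (near_bdval e chi) (near_bdval e psi).
exact: etrans (esym xe) ye.
Qed.

(** Convergence in the spectrum is pointwise, [bool] being discrete. *)
Lemma cvg_Jhat (F : set_system (@Jhat C)) (chi : @Jhat C) : Filter F ->
  (forall e, \forall psi \near F, val psi e = val chi e) -> F --> chi.
Proof.
move=> FF Fchi U; rewrite nbhsE => -[V [[W oW <-] chiW] VU].
apply: filterS VU _.
suff cv : (val : @Jhat C -> {ptws @J C -> bool}) @ F --> (val chi : {ptws @J C -> bool}).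
  have : nbhs (val chi : {ptws @J C -> bool}) W.
    by apply: open_nbhs_nbhs; split=> //; move: chiW; rewrite set_valE.
  by move=> /cv; rewrite set_valE.
apply/cvg_sup => e A; rewrite nbhsE => -[B [[D oD <-] chiD] BA].
by apply: filterS (Fchi e) => psi psie; apply: BA => /=; rewrite psie.
Qed.

(** An ultrafilter on this set converges to the character whose value at
    each f in J is the one taken almost everywhere.  The condition chi(e) = 1 keeps the
    limit from being zero: the whole boundary need not be compact. *)
Lemma compact_bdval e : compact [set chi : @bdOmega C | bdval chi e].
Proof.
rewrite compact_ultra => F FU Fe.
pose u f : bool := `[< F [set psi : @bdOmega C | bdval psi f] >].
have Fu f : \forall psi \near F, bdval psi f = u f.
  have [Ff|nFf] := pselect (F [set psi : @bdOmega C | bdval psi f]).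
    by apply: filterS (Ff) => psi psif; rewrite /u asboolT.
  have [//|] := in_ultra_setVsetC [set psi : @bdOmega C | bdval psi f] FU.
  by apply: filterS => psi /= /negP/negbTE ->; rewrite /u asboolF.
have uP : Jhat u.
  split.
  - by exists e; apply/asboolP.
  - move=> f g.
    have [psi [[/= <- <-] <-]] := filter_ex (filterI (filterI (Fu f) (Fu g)) (Fu (capJ f g))).
    exact: char_capJ.
  - move=> f f0; have [psi /= <-] := filter_ex (Fu f).
    by apply/negbTE; exact: char_empty.
pose chi : @Jhat C := SigSub (mem_set uP).
have cv : val @ F --> chi by apply: cvg_Jhat => f; exact: Fu.
have bdchi : bdOmega chi.
  rewrite /bdOmega; apply: (@closed_cvg _ _ F _ val (closure (@maxchar C))) => //.
  - exact: closed_closure.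
  - by apply: nearW => psi; exact: set_valP.
exists (SigSub (mem_set bdchi)); split; first by apply/asboolP.
move=> U; rewrite nbhsE => -[V [[W oW <-] chiW] VU].
apply: filterS VU _; rewrite set_valE; apply: cv.
by apply: open_nbhs_nbhs; split=> //; move: chiW; rewrite set_valE.
Qed.

End BoundarySpectrum.

(** * Germs *)

Section Germs.
Variable C : lcCategory.
Implicit Types (s t : @Il C) (chi psi : @bdOmega C) (eps : set C).

(** The germ of [u] at [chi] is that of an identity.  That [eps] is in Jbar is
    part of [chibar]. *)
Definition unit_germ (u : set (C * C)) chi : Prop :=
  exists2 eps, chibar (bdval chi) eps & fixes u eps.

Lemma unit_germ_bdval s chi : unit_germ (val s) chi -> bdval chi (domJ s).
Proof.
move=> [eps ceps seps]; apply: contraPT ceps => chis [e [n [f [ef chie chif]]]].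
(* As [eps] lies in the domain of [s], so may the sets defining it. *)
have ef' : is_diff (capJ e (domJ s)) (fun i => capJ (f i) (domJ s)) eps.
  have [fe epsE] := ef; split=> [i x [/= /fe]//|].
  apply/seteqP; split=> [x epsx|x [[/= ex sx] nf]]; last first.
    by rewrite epsE; split=> // -[i _ fx]; apply: nf; exists i.
  have := epsx; rewrite {1}epsE => -[ex nf]; split; last first.
    by move=> [i _ [/= fx _]]; apply: nf; exists i.
  by split=> //=; exists x; exact: seps.
have : chibar (bdval chi) eps by exists e, n, f.
move=> /(chibarE (bdOmega_Omega (set_valP chi)) ef')[].
by rewrite char_capJ (negbTE chis : val (val chi) (domJ s) = false) andbF.
Qed.

Lemma germ_eqP (p q : @germ_pair C) : germ p = germ q <->
  (val p).2 = (val q).2 /\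
  unit_germ ((val (val p).1)^-1 \; val (val q).1)%relation (val p).2.
Proof.
rewrite germP; split.
  move=> /asboolP[pq [eps [_ ceps seps]]]; split=> //.
  (* Restricted partial bijections may agree outside of both domains. *)
  exists (eps `&` val (domJ (val p).1)).
    by apply: chibarI => //; apply: chibar_J; exact: (set_valP p).
  move=> x [epsx [y sxy]]; exists y => //.
  have : restr (val (val p).1) eps (x, y) by split.
  by rewrite seps => -[].
move=> [pq [eps ceps feps]]; apply/asboolP; split=> //; exists eps; split=> //.
  exact: chibar_Jbar ceps.
have [sf _] := Il_bij (set_valP (val p).1).
have [tf _] := Il_bij (set_valP (val q).1).
apply/seteqP; split=> -[x y] [/= epsx xy]; split=> //=;
  have [u /= qxu pxu] := feps x epsx.
  by rewrite (sf _ _ _ xy pxu).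
by rewrite (tf _ _ _ xy qxu).
Qed.

Definition mkgerm s chi (h : bdval chi (domJ s)) : groupoid C :=
  germ (SigSub (mem_set (h : germ_pair (s, chi)))).

Lemma bisection_mkgerm s chi (h : bdval chi (domJ s)) : bisection s (mkgerm h).
Proof. by exists (SigSub (mem_set (h : germ_pair (s, chi)))). Qed.

Lemma source_mkgerm s chi (h : bdval chi (domJ s)) : source (mkgerm h) = chi.
Proof. exact: source_germ. Qed.

(** The basic neighbourhoods of [s, chi]: the germs of [s] at the points of [U]. *)
Lemma nbhs_germ (p : @germ_pair C) (U : set (@bdOmega C)) : nbhs (val p).2 U ->
  nbhs (germ p) (bisection (val p).1 `&` @source C @^-1` U).
Proof.
move=> chiU; apply: filterI.
  apply: open_nbhs_nbhs; split; first exact: bisection_open.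
  by exists p.
by apply: source_continuous; rewrite source_germ.
Qed.

Lemma nbhs_source (g : groupoid C) (A : set (groupoid C)) s :
  open A -> A g -> bisection s g ->
  nbhs (source g) (@source C @` (bisection s `&` A)).
Proof.
by move=> oA Ag sg; apply: open_nbhs_nbhs; split; [exact: oA|exists g].
Qed.

(** Where [s, chi] is not a unit, it differs from [s^-1 s, chi]; disjoint
    neighbourhoods of both project to neighbourhoods of chi, over whose
    intersection the germs of s and s^-1 s remain distinct. *)
Lemma closed_unit_germ s : hausdorff_space (groupoid C) ->
  closed [set chi | unit_germ (val s) chi].
Proof.
move=> HG; rewrite -[X in closed X]setCK; apply: open_closedC.
rewrite openE => chi /= nV.
have [chis|chis] := boolP (bdval chi (domJ s)); last first.
  apply: filterS (near_bdval (domJ s) chi) => psi psis /unit_germ_bdval.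
  by rewrite psis; exact/negP.
have Is := set_valP s.
have Ii : Il ((val s)^-1 \; val s)%relation by do ![constructor].
pose i : @Il C := SigSub (mem_set Ii).
have domi : domJ i = domJ s.
  apply/val_inj/seteqP; split=> [x [y [z xz _]]|x [y xy]]; first by exists z.
  by exists x, y.
have chii : bdval chi (domJ i) by rewrite domi.
have fixi eps : fixes ((val i)^-1 \; val s)%relation eps <-> fixes (val s) eps.
  have [_ si] := Il_bij Is; split=> fx x /fx; last first.
    by move=> xx; exists x => //; exists x.
  by move=> [u /= xu [v /= uv xv]]; rewrite -{2}(si _ _ _ xv uv).
have gh : mkgerm chii <> mkgerm chis.
  by move=> /germ_eqP[_ [eps ceps /fixi feps]]; apply: nV; exists eps.
have [/= [A B] [/= /set_mem gA /set_mem hB] [oA oB /eqP AB0]] :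
  exists2 AB, (mkgerm chii \in AB.1 /\ mkgerm chis \in AB.2) &
    [/\ open AB.1, open AB.2 & AB.1 `&` AB.2 == set0].
  by move: HG; rewrite open_hausdorff; apply; apply/eqP.
have nA := nbhs_source oA gA (bisection_mkgerm chii).
have nB := nbhs_source oB hB (bisection_mkgerm chis).
rewrite source_mkgerm in nA; rewrite source_mkgerm in nB.
apply: filterS (filterI nA nB) => psi [].
move=> [_ [[p pi <-] pA] ppsi] [_ [[q qs <-] qB] qpsi] [eps ceps feps].
rewrite source_germ in ppsi; rewrite source_germ in qpsi.
rewrite -[False]/(set0 (germ p)) -AB0; split=> //.
rewrite (_ : germ p = germ q) //; apply/germ_eqP; split; first by rewrite ppsi.
by exists eps; rewrite ?ppsi// pi qs; exact/fixi.
Qed.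

End Germs.

(** * The criterion *)

(** Finitely many [eps] fixed by [u] meet every nonempty member of J fixed
    by [u]. *)
Definition finitely_fixed (C : lcCategory) (u : set (C * C)) : Prop :=
  exists n (eps : 'I_n -> set C),
    (forall i, Jbar (eps i) /\ fixes u (eps i)) /\
    forall e : set C, J e -> e !=set0 -> fixes u e ->
      exists i : 'I_n, e `&` eps i !=set0.

Lemma hausdorff_finitely_fixed (C : lcCategory) (s : @Il C) :
  hausdorff_space (groupoid C) -> finitely_fixed (val s).
Proof.
move=> HG; pose V := [set chi : @bdOmega C | unit_germ (val s) chi].
have cV : compact V.
  apply: subclosed_compact (closed_unit_germ HG) (@compact_bdval C (domJ s)) _.
  by move=> chi; exact: unit_germ_bdval.
have [|chi [eps ceps feps]|l lgood lcov] := compact_finite_subcover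
    (D := [set eps | Jbar eps /\ fixes (val s) eps])
    (U := fun eps => [set chi : @bdOmega C | chibar (bdval chi) eps]) cV.
- by move=> eps _; exact: open_chibar.
- by exists eps => //; split=> //; exact: chibar_Jbar ceps.
exists (size l), (fun i : 'I_(size l) => nth set0 l i); split.
  by move=> i; apply: lgood; exact: mem_nth.
move=> e0 Je0 e00 fe; pose e : @J C := SigSub (mem_set Je0).
have [chi0 mchi chie] : exists2 chi : @Jhat C, maxchar chi & val chi e.
  exact: ex_maxchar.
pose chi : @bdOmega C := SigSub (mem_set (subset_closure mchi)).
have ce : chibar (bdval chi) e0 by exact: (@chibar_J C chi0 e).
have [|eps epsl ceps] := lcov chi; first by exists e0.
have il : index eps l < size l by rewrite index_mem.
exists (Ordinal il); rewrite /= nth_index//.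
exact: chibar_nonempty (maxchar_Omega mchi) (chibarI ce ceps).
Qed.

Lemma finitely_fixed_hausdorff (C : lcCategory) :
  (forall s : set (C * C), Il s -> finitely_fixed s) ->
  hausdorff_space (groupoid C).
Proof.
move=> HF g h clgh.
have src : source g = source h.
  apply: bdOmega_hausdorff => A B nA nB.
  have [k [kA kB]] := clgh _ _ (source_continuous nA) (source_continuous nB).
  by exists (source k).
rewrite -(germ_repr g) -(germ_repr h) in clgh src *.
move: (repr _) (repr _) clgh src => q p clpq.
rewrite !source_germ => pq.
pose u := ((val (val p).1)^-1 \; val (val q).1)%relation.
have [n [eps [epsP epsF]]] : finitely_fixed u.
  by apply: HF; do ![constructor]; exact: set_valP.
have Jeps i : Jbar (eps i) := (epsP i).1.
apply: contrapT => npq.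
have nchi i : ~ chibar (bdval (val p).2) (eps i).
  move=> ceps; apply: npq; apply/germ_eqP; split=> //; exists (eps i) => //.
  exact: (epsP i).2.
have nU := near_bdnchibar_all Jeps nchi.
have nUq := nU; rewrite pq in nUq.
have [k [[[p' p's <-] /= Up] [[q' q't p'q'] _]]] :=
  clpq _ _ (nbhs_germ nU) (nbhs_germ nUq).
move: Up; rewrite source_germ => Up.
have /germ_eqP[_ [del cdel]] := esym p'q'; rewrite p's q't => fdel.
have [psi [cpsi npsi] mpsi] :=
  near_maxchar (filterI (near_bdchibar cdel) (near_bdnchibar_all Jeps Up)).
have [d psid ddel] := maxchar_chibar mpsi cpsi.
have /choice[a aP] i :
    exists a : @J C, val (val psi) a /\ val a `&` eps i = set0.
  by have [a] := maxchar_nchibar mpsi (Jeps i) (npsi i); exists a.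
have [e psie [ed ea]] := char_lower_bound psid (fun i => (aP i).1).
have [i [x [ex epsx]]] : exists i, val e `&` eps i !=set0.
  apply: epsF; [exact: set_valP|exact: char_nonempty psie|].
  by move=> x /ed /ddel /fdel.
by rewrite -[False]/(set0 x) -(aP i).2; split=> //; exact: ea.
Qed.

Theorem lemma5p2 (C : lcCategory) :
  hausdorff_space (groupoid C) <->
  forall s : set (C * C), Il s ->
    exists n (eps : 'I_n -> set C),
      (forall i, Jbar (eps i) /\ fixes s (eps i)) /\
      forall e : set C, J e -> e !=set0 -> fixes s e ->
        exists i : 'I_n, e `&` eps i !=set0.
Proof.
split; last exact: finitely_fixed_hausdorff.
by move=> HG s Is; exact: (@hausdorff_finitely_fixed C (SigSub (mem_set Is))).
Qed.
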